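(* Let $n\ge1$ and $x\ge0$ be integers, and let $L(C_{n,x})$ be the number of lozenge tilings of the region $C_{n,x}$ defined in the context. Then $$L(C_{n,x})=\det\left(\binom{x+i+j}{2j-i}\right)_{0\le i,j\le n-1}.$$ Moreover, the determinant $$\det\left(\binom{x+i+j}{2j-i}\right)_{0\le i,j\le n-1}$$ can be expressed as a product of linear factors in $x$.
   Context: Work on the regular triangular lattice with unit edges, with one family of lattice lines horizontal. A lozenge is a unit rhombus with angles $60^\circ$ and $120^\circ$ (the union of two unit triangles sharing an edge). A lozenge tiling of a region (a finite union of unit triangles) is a covering of it by lozenges without gaps or overlaps. $C_{n,x}$ is the pentagonal region whose top side is horizontal of length $x$, whose southeastern side is straight of length $n$, whose western and northeastern sides follow zig-zag lattice paths of length $2n$, and whose bottom side is horizontal. Explicitly, with directions measured counterclockwise from east: starting at the left end of the top side, the western side goes downward by $2n$ unit steps alternately in directions $-60^\circ,-120^\circ,-60^\circ,-120^\circ,\dots$. Starting at the right end of the top side, the northeastern side consists of $2n$ unit steps alternately in directions $-60^\circ,0^\circ,-60^\circ,0^\circ,\dots$; it is followed by the southeastern side, $n$ unit steps in direction $-120^\circ$. The bottom side joins the lower ends of the western and southeastern sides. All tile positions have weight $1$, so $L(C_{n,x})$ is simply the number of lozenge tilings. Binomial coefficients: $\binom{a}{m}=a(a-1)\cdots(a-m+1)/m!$ for integers $m\ge0$ and $\binom{a}{m}=0$ for integers $m<0$, so the entries of the matrix are polynomials in $x$. *)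

(* Defs.v *)
From HB Require Import structures.
From mathcomp Require Import all_boot all_order all_algebra.
From mathcomp Require Import finmap zify.

Set Implicit Arguments.
Unset Strict Implicit.
Unset Printing Implicit Defensive.

Import Order.TTheory GRing.Theory Num.Theory.
Local Open Scope ring_scope.

(* The vertex (a, b) is the lattice point a * u + b * v, where u and v are
   the unit vectors pointing in directions 0 and 60 degrees. *)
Notation vertex := (int * int)%type.

Definition dir0 : vertex := (1, 0).
Definition dirm60 : vertex := (1, -1).
Definition dirm120 : vertex := (0, -1).

(* ((a, b), false) is the upward-pointing unit triangle whose lower left
   corner is (a, b), and ((a, b), true) is the downward-pointing one sharing
   its northeastern edge. *)
Notation triangle := (int * int * bool)%type.

Definition corners (t : triangle) : seq vertex :=
  let: (a, b, down) := t in
  [:: (a + 1, b); (a, b + 1); if down then (a + 1, b + 1) else (a, b)].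

Definition share_edge (s t : triangle) : bool :=
  count (mem (corners s)) (corners t) == 2.

Definition is_lozenge (D : {fset triangle}) (B : {set D}) : bool :=
  [exists s : D, [exists t : D,
    share_edge (val s) (val t) && (B == [set s; t])]].

Definition lozenge_tilings (D : {fset triangle}) : {set {set {set D}}} :=
  [set P | partition P [set: D] && [forall B in P, is_lozenge B]].

Definition edges (p : vertex) (ds : seq vertex) : seq (vertex * vertex) :=
  zip (p :: scanl +%R p ds) (scanl +%R p ds).

(* The edge pq meets the horizontal line at height b + 1/2 in direction v iff
   it joins heights b and b + 1, and then it does so at its midpoint (p + q)/2.
   On that line the triangle ((a, b), false) occupies the first coordinates
   between a and a + 1/2, and ((a, b), true) those between a + 1/2 and a + 1. *)
Definition crosses_west (t : triangle) (e : vertex * vertex) : bool :=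
  let: (a, b, down) := t in
  (e.1.2 + e.2.2 == 2 * b + 1) && (e.1.1 + e.2.1 <= 2 * a + down%:R).

(* Even-odd rule for the ray going west from an interior point of t. *)
Definition enclosed (p : vertex) (ds : seq vertex) (t : triangle) : bool :=
  odd (count (crosses_west t) (edges p ds)).

Definition western_side (n : nat) : seq vertex :=
  flatten (nseq n [:: dirm60; dirm120]).
Definition northeastern_side (n : nat) : seq vertex :=
  flatten (nseq n [:: dirm60; dir0]).
Definition southeastern_side (n : nat) : seq vertex := nseq n dirm120.

(* Clockwise from the left end of the top side; the bottom side has length
   x + n, as [C_boundary_closed] confirms. *)
Definition C_start (n : nat) : vertex := (0, (2 * n)%N%:Z).
Definition C_boundary (n x : nat) : seq vertex :=
  nseq x dir0 ++ northeastern_side n ++ southeastern_side n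
  ++ nseq (x + n) (- dir0) ++ rev (map -%R (western_side n)).

(* The bounding box of the boundary loses nothing: see [mem_C_region]. *)
Definition C_box (n x : nat) : seq triangle :=
  [seq (Posz ab.1, Posz ab.2, down) |
    ab <- [seq (a, b) | a <- iota 0 (x + 2 * n), b <- iota 0 (2 * n)],
    down <- [:: false; true]].

Definition C_region (n x : nat) : {fset triangle} :=
  [fset t in C_box n x | enclosed (C_start n) (C_boundary n x) t]%fset.

Lemma C_boundary_out (n x : nat) :
  \sum_(d <- nseq x dir0 ++ northeastern_side n ++ southeastern_side n) d
    = ((x + 2 * n)%N%:Z, - (2 * n)%N%:Z).
Proof.
have nseqE k (d : vertex) : \sum_(e <- nseq k d) e = (d.1 * k%:Z, d.2 * k%:Z).
  elim: k => [|k IHk] /=; first by rewrite big_nil !mulr0.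
  by rewrite big_cons IHk; case: d {IHk} => d1 d2; congr (_, _) => /=; lia.
have neE : \sum_(d <- northeastern_side n) d = ((2 * n)%N%:Z, - n%:Z).
  rewrite /northeastern_side; elim: n => [|n IHn] /=; first by rewrite big_nil.
  by rewrite !big_cons IHn; congr (_, _) => /=; lia.
by rewrite !big_cat /= neE !nseqE; congr (_, _) => /=; lia.
Qed.

Lemma C_boundary_back (n x : nat) :
  \sum_(d <- nseq (x + n) (- dir0) ++ rev (map -%R (western_side n))) d
    = (- (x + 2 * n)%N%:Z, (2 * n)%N%:Z).
Proof.
have nseqE k (d : vertex) : \sum_(e <- nseq k d) e = (d.1 * k%:Z, d.2 * k%:Z).
  elim: k => [|k IHk] /=; first by rewrite big_nil !mulr0.
  by rewrite big_cons IHk; case: d {IHk} => d1 d2; congr (_, _) => /=; lia.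
have wE : \sum_(d <- western_side n) d = (n%:Z, - (2 * n)%N%:Z).
  rewrite /western_side; elim: n => [|n IHn] /=; first by rewrite big_nil.
  by rewrite !big_cons IHn; congr (_, _) => /=; lia.
rewrite big_cat /= (perm_big _ (permEl (perm_rev _))) big_map sumrN wE nseqE.
by congr (_, _) => /=; lia.
Qed.

Lemma C_boundary_closed (n x : nat) : \sum_(d <- C_boundary n x) d = 0.
Proof.
have -> : C_boundary n x =
    (nseq x dir0 ++ northeastern_side n ++ southeastern_side n)
    ++ nseq (x + n) (- dir0) ++ rev (map -%R (western_side n)).
  by rewrite /C_boundary -!catA.
rewrite big_cat C_boundary_out C_boundary_back; congr (_, _) => /=; lia.
Qed.

Lemma edges_cons p d ds : edges p (d :: ds) = (p, p + d) :: edges (p + d) ds.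
Proof. by []. Qed.

Lemma edges_cat p ds1 ds2 :
  edges p (ds1 ++ ds2) = edges p ds1 ++ edges (p + \sum_(d <- ds1) d) ds2.
Proof.
elim: ds1 p => [|d ds1 IH] p; first by rewrite big_nil addr0.
by rewrite cat_cons !edges_cons IH big_cons addrA.
Qed.

Definition in_box (M N : int) (v : vertex) : bool :=
  (0 <= v.1 <= M) && (0 <= v.2 <= N).

Lemma edges_SE M N p ds :
    all (fun d : vertex => (0 <= d.1) && (d.2 <= 0)) ds ->
    in_box M N p -> in_box M N (p + \sum_(d <- ds) d) ->
  all (fun e => in_box M N e.1 && in_box M N e.2) (edges p ds).
Proof.
elim: ds p => [//|d ds IH] p /= /andP[/andP[d1 d2] dsP] pP.
rewrite -/(edges (p + d) ds) big_cons addrA => lP.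
suff pdP : in_box M N (p + d) by rewrite pP pdP IH.
have : (0 <= (\sum_(e <- ds) e).1) && ((\sum_(e <- ds) e).2 <= 0).
  elim: ds dsP {IH lP} => [|e ds IH] /=; first by rewrite big_nil.
  move=> /andP[/andP[e1 e2] /IH /andP[h1 h2]]; rewrite big_cons /=.
  by rewrite addr_ge0 // -oppr_ge0 opprD addr_ge0 ?oppr_ge0.
move: lP pP; rewrite /in_box /=; case: (\sum_(e <- ds) e) => u v /=; lia.
Qed.

Lemma edges_NW M N p ds :
    all (fun d : vertex => (d.1 <= 0) && (0 <= d.2)) ds ->
    in_box M N p -> in_box M N (p + \sum_(d <- ds) d) ->
  all (fun e => in_box M N e.1 && in_box M N e.2) (edges p ds).
Proof.
elim: ds p => [//|d ds IH] p /= /andP[/andP[d1 d2] dsP] pP.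
rewrite -/(edges (p + d) ds) big_cons addrA => lP.
suff pdP : in_box M N (p + d) by rewrite pP pdP IH.
have : ((\sum_(e <- ds) e).1 <= 0) && (0 <= (\sum_(e <- ds) e).2).
  elim: ds dsP {IH lP} => [|e ds IH] /=; first by rewrite big_nil.
  move=> /andP[/andP[e1 e2] /IH /andP[h1 h2]]; rewrite big_cons /=.
  by rewrite andbC addr_ge0 // -oppr_ge0 opprD addr_ge0 ?oppr_ge0.
move: lP pP; rewrite /in_box /=; case: (\sum_(e <- ds) e) => u v /=; lia.
Qed.

Lemma C_boundary_box (n x : nat) :
  all (fun e => in_box (x + 2 * n)%N (2 * n)%N e.1
                && in_box (x + 2 * n)%N (2 * n)%N e.2)
    (edges (C_start n) (C_boundary n x)).
Proof.
have -> : C_boundary n x =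
    (nseq x dir0 ++ northeastern_side n ++ southeastern_side n)
    ++ nseq (x + n) (- dir0) ++ rev (map -%R (western_side n)).
  by rewrite /C_boundary -!catA.
rewrite edges_cat all_cat; apply/andP; split.
  apply: edges_SE; rewrite ?C_boundary_out; try by rewrite /in_box /=; lia.
  rewrite !all_cat !all_nseq /= !orbT andbT /=; apply/allP => d /flattenP[s].
  by rewrite mem_nseq => /andP[_ /eqP->]; rewrite !inE => /orP[] /eqP->.
rewrite C_boundary_out; apply: edges_NW;
  rewrite ?C_boundary_back; try by rewrite /in_box /=; lia.
rewrite all_cat all_nseq all_rev all_map /= orbT /=; apply/allP => d /flattenP[s].
by rewrite mem_nseq => /andP[_ /eqP->]; rewrite !inE => /orP[] /eqP->.
Qed.

Lemma odd_row_crossings (b : int) p ds :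
    all (fun d : vertex => -1 <= d.2 <= 1) ds ->
  odd (count (fun e : vertex * vertex => e.1.2 + e.2.2 == 2 * b + 1)
        (edges p ds))
  = (p.2 <= b) (+) ((p + \sum_(d <- ds) d).2 <= b).
Proof.
elim: ds p => [|d ds IH] p; first by rewrite big_nil addr0 addbb.
rewrite edges_cons big_cons (addrA p) => /andP[dP dsP].
rewrite [count _ _]/= oddD IH // addbA; congr (_ (+) _); move: p d dP {IH} => [p1 p2] [d1 d2] /=.
by case: eqP => /=; case: (lerP p2 b); case: (lerP (p2 + d2) b) => //=; lia.
Qed.

Lemma enclosed_box (n x : nat) (a b : int) (down : bool) :
    enclosed (C_start n) (C_boundary n x) (a, b, down) ->
  (0 <= a < (x + 2 * n)%N) && (0 <= b < (2 * n)%N).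
Proof.
rewrite /enclosed => oddP; have /allP boxP := C_boundary_box n x.
have : has (crosses_west (a, b, down)) (edges (C_start n) (C_boundary n x)).
  by rewrite has_count; case: (count _ _) oddP.
case/hasP=> e /[dup] eE /boxP; rewrite /in_box /= => boxe eP.
have [lta|gea] := ltrP a (x + 2 * n)%N; first by case: down {oddP} eP; lia.
suff evenP : ~~ odd (count (crosses_west (a, b, down))
                       (edges (C_start n) (C_boundary n x))) by rewrite oddP in evenP.
rewrite (@eq_in_count _ _
  (fun e : vertex * vertex => e.1.2 + e.2.2 == 2 * b + 1)); last first.
  by move=> f /boxP; rewrite /in_box /=; case: down {oddP eP}; lia.
rewrite odd_row_crossings ?C_boundary_closed ?addr0 ?addbb //.
rewrite !all_cat all_rev all_map !all_nseq /= !orbT /=.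
by apply/andP; split; apply/allP => d /flattenP[s]; rewrite mem_nseq
  => /andP[_ /eqP->]; rewrite !inE => /orP[] /eqP->.
Qed.

Lemma mem_C_region (n x : nat) (t : triangle) :
  (t \in C_region n x) = enclosed (C_start n) (C_boundary n x) t.
Proof.
rewrite !inE; have [tP|_] := boolP (enclosed _ _ t); last by rewrite andbF.
rewrite andbT; case: t tP => [[a b] down] /enclosed_box /andP[aP bP].
apply/allpairsPdep; exists (`|a|%N, `|b|%N), down; split=> /=.
- by apply/allpairsPdep; exists `|a|%N, `|b|%N; rewrite !mem_iota; split=> //; lia.
- by case: down.
- by congr (_, _, _); lia.
Qed.

(* The binomial coefficient a(a-1)...(a-m+1)/m! for a in any ring where m! is
   invertible; it is used with rat and {poly rat}. *)
Definition gbinom (R : comUnitRingType) (a : R) (m : int) : R :=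
  match m with
  | Posz k => (\prod_(i < k) (a - i%:R)) / (k`!)%:R
  | Negz _ => 0
  end.

Definition binom_mx (R : comUnitRingType) (n : nat) (x : R) : 'M[R]_n :=
  \matrix_(i < n, j < n) gbinom (x + i%:R + j%:R) (2 * j%:Z - i%:Z).

(* Main.v *)
Require Import Defs.
From mathcomp Require Import all_boot all_order all_algebra.
From mathcomp Require Import finmap zify ring lra.

Set Implicit Arguments.
Unset Strict Implicit.
Unset Printing Implicit Defensive.

Import Order.TTheory GRing.Theory Num.Theory.
Local Open Scope ring_scope.

(** Tilings. A tiling is a perfect matching of up and down unit triangles;
equivalently, a family of non-intersecting paths crossing the edges of direction
120 degrees, from the n zig-zag edges of the northeastern side to n edges of
the western one, with 'C(x + i + j, 2j - i) single paths from the i-th to the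
j-th. Instead of path families we keep only the current positions p_j of the n
particles and match the up triangles one at a time from east to west. If a
particle waits at the next up triangle it moves west or southwest, and the
number of completions splits like the determinant of (paths from p_j to the
i-th end), which is linear in row j and vanishes when two particles meet;
otherwise the match is forced.

Product formula. The row operation sum_k row_coef n k * (row k), k = 1..n,
kills the columns j < n. The resulting sums satisfy a recurrence in (n, j),
found by Zeilberger's algorithm, which gives both the vanishing for j < n and
the value at j = n; the determinant is the product of the ratios of that value
to the diagonal coefficient, and by the recurrence consecutive ratios differ by
quotients of linear factors. This holds at every natural x, hence as an identity
of polynomials, and a divisor of a product of linear factors is one. *)

(** * Perfect matchings *)

Section Matchings.

Variables (T : finType) (adj : rel T).
Hypotheses (adj_sym : symmetric adj) (adj_irr : irreflexive adj).

Definition is_domino (B : {set T}) : bool :=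
  [exists s : T, [exists t : T, adj s t && (B == [set s; t])]].

Definition matchings (A : {set T}) : {set {set {set T}}} :=
  [set P | partition P A && [forall B in P, is_domino B]].

Lemma card_matchings0 : #|matchings set0| = 1%N.
Proof.
apply/eqP/cards1P; exists set0; apply/setP => P; rewrite !inE partition_set0.
by apply/andP/eqP => [[/eqP]|->] //; split=> //; apply/forall_inP => B; rewrite inE.
Qed.

Lemma is_domino_mem B t : is_domino B -> t \in B ->
  exists2 s, adj t s & B = [set t; s].
Proof.
case/existsP=> s /existsP[u /andP[su /eqP->]]; rewrite !inE => /orP[]/eqP->.
  by exists u.
by exists s; rewrite ?[adj u s]adj_sym // setUC.
Qed.

Lemma domino_inj t s s' : adj t s -> [set t; s] = [set t; s'] -> s = s'.
Proof.
move=> ts /setP /(_ s); rewrite !inE eqxx orbT => /esym /orP[]/eqP // st.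
by rewrite st adj_irr in ts.
Qed.

(** Removing the block [[set t; s]] is a bijection, inverse to adding it back. *)
Lemma card_matchings_domino (A : {set T}) t s :
    t \in A -> s \in A -> adj t s ->
  #|[set P in matchings A | [set t; s] \in P]| = #|matchings (A :\ t :\ s)|.
Proof.
move=> tA sA ts; set B := [set t; s].
have AB : A :\: B = A :\ t :\ s by rewrite setDDl.
have BA : B :|: A :\: B = A.
  apply/setP => u; rewrite !inE; case: eqP => [->|_] //=.
  by case: eqP => [->|].
have B0 : B != set0 by apply/set0Pn; exists t; rewrite !inE eqxx.
have BD (P : {set {set T}}) : partition P (A :\: B) -> B \notin P.
  move=> PP; apply/negP => BP.
  have : t \in A :\: B.
    by rewrite -(cover_partition PP); apply/bigcupP; exists B; rewrite // !inE eqxx.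
  by rewrite !inE eqxx.
rewrite -[RHS](@card_in_imset _ _ (fun P => B |: P)); last first.
  move=> P Q; rewrite -AB !inE => /andP[/BD BP _] /andP[/BD BQ _] e.
  by rewrite -[P](setU1K BP) e setU1K.
apply: eq_card => P; rewrite !inE; apply/andP/imsetP.
  case=> /andP[PA /forall_inP PD] BP; exists (P :\ B); last by rewrite setD1K.
  rewrite inE -AB partitionD1 //=; apply/forall_inP => C; rewrite !inE.
  by case/andP=> _ /PD.
case=> Q; rewrite -AB inE => /andP[QA /forall_inP QD] ->; split; last by rewrite setU11.
apply/andP; split.
  rewrite -BA partitionU1 //.
  by rewrite -setI_eq0; apply/eqP/setP => u; rewrite !inE andbC -andbA andbCA andNb andbF.
apply/forall_inP => C; rewrite !inE => /orP[/eqP->|/QD //].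
by apply/existsP; exists t; apply/existsP; exists s; rewrite ts eqxx.
Qed.

Lemma card_matchings_rec (A : {set T}) t : t \in A ->
  #|matchings A| = (\sum_(s in A | adj t s) #|matchings (A :\ t :\ s)|)%N.
Proof.
move=> tA.
transitivity (\sum_(s in A | adj t s)
    \sum_(P in matchings A | [set t; s] \in P) 1)%N; last first.
  apply: eq_bigr => s /andP[sA ts]; rewrite -card_matchings_domino // -sum1_card.
  by apply: eq_bigl => P; rewrite !inE.
rewrite (exchange_big_dep (mem (matchings A))) /=; last by move=> s P _ /andP[].
rewrite -sum1_card; apply: eq_bigr => P.
rewrite /= => PM; have := PM; rewrite inE => /andP[PA /forall_inP PD].
have [B BP tB] : exists2 B, B \in P & t \in B.
  by move: tA; rewrite -(cover_partition PA) => /bigcupP[B]; exists B.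
have [s ts eB] := is_domino_mem (PD B BP) tB.
rewrite (big_pred1 s) // => s' /=.
apply/idP/eqP => [/andP[/andP[s'A ts'] /andP[_ BP']]|->]; last first.
  rewrite ts -eB BP; move: PM; rewrite inE => ->; rewrite !andbT.
  rewrite -(cover_partition PA); apply/bigcupP; exists B => //.
  by rewrite eB !inE eqxx orbT.
have /and3P[_ /trivIsetP triv _] := PA.
apply: (domino_inj ts'); rewrite -eB; apply/eqP; apply/negPn/negP => ne.
have := triv _ _ BP' BP ne; rewrite disjoint_subset => /subsetP /(_ t).
by rewrite !inE eqxx tB => /(_ isT).
Qed.

End Matchings.

(** * Peeling off up triangles *)

(* The pair (a + b + 1, b) names the edge of direction 120 degrees shared by
   the triangles ((a, b), false) and ((a, b), true). *)
Definition edge_of (t : triangle) : int * int := (t.1.1 + t.1.2 + 1, t.1.2).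
Definition tri_of (e : int * int) (down : bool) : triangle :=
  (e.1 - e.2 - 1, e.2, down).

(** The first coordinate acts as time and the second as height. A lozenge that covers an up triangle
    across its west or bottom side leads to one of these two edges, like the two terms of Pascal's
    rule. *)
Definition stepW (e : int * int) : int * int := (e.1 - 1, e.2).
Definition stepSW (e : int * int) : int * int := (e.1 - 1, e.2 - 1).

Lemma edge_ofK t : tri_of (edge_of t) t.2 = t.
Proof. by case: t => [[a b] d]; rewrite /tri_of /=; congr (_, _, _); lia. Qed.

Lemma tri_ofK e d : edge_of (tri_of e d) = e.
Proof. by case: e => [a b]; rewrite /edge_of /=; congr (_, _); lia. Qed.

Lemma share_edge_sym : symmetric share_edge.
Proof.
have corners_uniq t : uniq (corners t).
  by case: t => [[a b] []]; rewrite /= !inE !xpair_eqE; lia.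
move=> s t; rewrite /share_edge -!size_filter; congr (_ == 2)%N.
apply: perm_size; apply: uniq_perm; rewrite ?filter_uniq // => z.
by rewrite !mem_filter andbC.
Qed.

Lemma share_edge_translate a b d a' b' d' :
  share_edge (a, b, d) (a', b', d') = share_edge (0, 0, d) (a' - a, b' - b, d').
Proof.
have tr a0 b0 x y e :
    corners (a0 + x, b0 + y, e) = map (fun z => z + (x, y)) (corners (a0, b0, e)).
  by rewrite /=; congr [:: _; _; _]; case: e => //=; congr (_, _) => /=; lia.
rewrite /share_edge -[a in (a, b, d)]add0r -[b in (_ + a, b, d)]add0r.
rewrite -{1}[a'](subrK a) -{1}[b'](subrK b) !tr count_map; congr (_ == 2)%N.
by apply: eq_count => z; apply: mem_map; apply: addIr.
Qed.

Lemma share_edge_orient s t : s.2 = t.2 -> share_edge s t = false.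
Proof.
case: s t => [[a b] d] [[a' b'] d'] /= <-; rewrite share_edge_translate.
by case: d (a' - a) (b' - b) => [] [[|[|[|?]]]|[|[|?]]] [[|[|[|?]]]|[|[|?]]].
Qed.

Lemma share_edge_up s t : s.2 = false ->
  share_edge s t = t.2 && [|| edge_of t == edge_of s,
    edge_of t == stepW (edge_of s) | edge_of t == stepSW (edge_of s)].
Proof.
case: s t => [[a b] d] [[a' b'] d'] /= ->; case: d'; last exact: share_edge_orient.
rewrite share_edge_translate /edge_of /stepW /stepSW !xpair_eqE /=.
have -> : a' = (a' - a) + a by rewrite subrK.
have -> : b' = (b' - b) + b by rewrite subrK.
rewrite !addrK; move: (a' - a) (b' - b) => x y.
have -> : (x + a + (y + b) + 1 == a + b + 1) && (y + b == b) = (x == 0) && (y == 0).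
  by lia.
have -> : (x + a + (y + b) + 1 == a + b) && (y + b == b) =
  (x == - 1) && (y == 0) by lia.
have -> : (x + a + (y + b) + 1 == a + b) && (y + b == b - 1) =
  (x == 0) && (y == - 1) by lia.
by case: x y => [[|[|[|?]]]|[|[|?]]] [[|[|[|?]]]|[|[|?]]].
Qed.

(** Sweep order of the up triangles: by decreasing first coordinate, and from bottom to top where it
    is constant, so that a lower particle moves before a higher one. *)
Definition before (e f : int * int) : bool :=
  (f.1 < e.1) || (e.1 == f.1) && (e.2 < f.2).

Lemma before_trans : transitive before.
Proof. by move=> [a b] [c d] [e f]; rewrite /before /=; lia. Qed.

Lemma ord_increasing_id n (f : 'I_n -> 'I_n) :
  (forall i j : 'I_n, (i < j)%N -> (f i < f j)%N) -> f =1 id.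
Proof.
move=> fM i; apply: val_inj => /=; apply/eqP; rewrite eqn_leq; apply/andP; split.
  have H : forall k (j : 'I_n), (n - j <= k)%N -> (f j <= j)%N.
    elim=> [|k IH] j hk; first by have := ltn_ord j; lia.
    case: (ltnP j.+1 n) => h; last by have := ltn_ord (f j); lia.
    have := fM j (Ordinal h) (leqnn _); have := IH (Ordinal h); rewrite /=; lia.
  exact: (H n i (leq_subr _ _)).
have H : forall k (j : 'I_n), (j <= k)%N -> (j <= f j)%N.
  elim=> [|k IH] j hk; first by lia.
  case: (posnP j) => h; first by rewrite h.
  have h' : (j.-1 < n)%N by have := ltn_ord j; lia.
  have hl : (Ordinal h' < j)%N by rewrite /= prednK.
  have := fM _ _ hl; have := IH (Ordinal h'); rewrite /=; lia.
exact: (H _ i (leqnn _)).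
Qed.

Section Peeling.

Variables (R : comNzRingType) (D : {fset triangle}) (n : nat).
Variables (ent : 'I_n -> int * int) (v : 'I_n -> int * int -> R).

Let U e := tri_of e false \in D.
Let W e := tri_of e true \in D.

(** [ent] lists the exits from top to bottom, and [v i e] counts the paths from [e] to exit [i]; by
    [v_W] and [v_SW] a step out of the region contributes nothing. *)
Hypothesis entW : forall e, W e -> ~~ U e -> e \in codom ent.
Hypothesis ent_lt : forall i e, U e -> e.2 = (ent i).2 + 1 -> (ent i).1 < e.1.
Hypothesis ent_desc : forall i j : 'I_n, (i < j)%N -> (ent j).2 < (ent i).2.
Hypothesis v_rec : forall i e, U e -> v i e = v i (stepW e) + v i (stepSW e).
Hypothesis v_W : forall i e, U e -> ~~ W (stepW e) -> v i (stepW e) = 0.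
Hypothesis v_SW : forall i e, U e -> ~~ W (stepSW e) -> v i (stepSW e) = 0.
Hypothesis v_ent : forall i j, v i (ent j) = (i == j)%:R.

Let adj (s t : D) := share_edge (val s) (val t).

(* What is left once all up triangles outside l have been matched, where the
   particle j sits on the edge p j, its down triangle being used already. *)
Definition remaining (l : seq (int * int)) (p : 'I_n -> int * int) : {set D} :=
  [set t : D | let e := edge_of (val t) in
    if (val t).2 then ((e \in l) || ~~ U e) && (e \notin codom p) else e \in l].

Definition move_to (p : 'I_n -> int * int) j d : 'I_n -> int * int :=
  fun j' => if j' == j then d else p j'.

(* By [legal_desc] and [legal_close], particles cannot cross without meeting. *)
Record legal (l : seq (int * int)) (p : 'I_n -> int * int) : Prop := Legal {
  legal_sorted : sorted before l;
  legal_up : forall e, e \in l -> U e;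
  legal_final : forall e f, e \in l -> U f -> before e f -> f \in l;
  legal_desc : forall i j : 'I_n, (i < j)%N -> (p j).2 < (p i).2;
  legal_close : forall i j : 'I_n, (i < j)%N -> p i \in l ->
    (p i).1 - 1 <= (p j).1;
  legal_pos : forall j, (p j \in l) || (p j \in codom ent);
  legal_cover : forall e, e \in l -> ~~ W e -> e \in codom p }.

Definition path_mx (p : 'I_n -> int * int) : 'M[R]_n := \matrix_(j, i) v i (p j).

Lemma eq_tri (s t : D) :
  (s == t) = (edge_of (val s) == edge_of (val t)) && ((val s).2 == (val t).2).
Proof.
rewrite -val_eqE; apply/eqP/andP => [->|[/eqP e /eqP o]]; first by rewrite !eqxx.
by rewrite -(edge_ofK (val s)) e o edge_ofK.
Qed.

Lemma W_val (s : D) : (val s).2 -> W (edge_of (val s)).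
Proof. by move=> o; rewrite /W -[X in tri_of _ X]o edge_ofK; apply: valP. Qed.

(** Every particle has reached an exit, and the vertical order forces particle [j] onto exit [j].
    Nothing is left to match, and the path matrix is the identity. *)
Lemma card_remaining_nil p : legal [::] p ->
  #|matchings adj (remaining [::] p)|%:R = \det (path_mx p).
Proof.
move=> L; have /fin_all_exists[f pf] : forall j, exists i, p j = ent i.
  move=> j; have /orP[|/codomP[i ei]] := legal_pos L j; first by rewrite in_nil.
  by exists i.
have fid : f =1 id.
  apply: ord_increasing_id => i j ij.
  have := legal_desc L ij; rewrite !pf.
  case: (ltngtP (f i) (f j)) => // [/ent_desc|/val_inj ->]; last by rewrite ltxx.
  by move=> h1 h2; have := lt_trans h1 h2; rewrite ltxx.
have -> : remaining [::] p = set0.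
  apply/setP => s; rewrite !inE /=; case: ifP => // o.
  apply/negP => /andP[nU /negP[]].
  have /codomP[i ->] := entW (W_val o) nU.
  by apply/codomP; exists i; rewrite pf fid.
rewrite card_matchings0; have -> : path_mx p = 1%:M; last by rewrite det1.
by apply/matrixP => j i; rewrite !mxE pf fid v_ent eq_sym.
Qed.

Lemma legal_head_notin e l p : legal (e :: l) p -> e \notin l.
Proof.
move=> L; have := legal_sorted L; rewrite /= (path_sortedE before_trans).
by case/andP=> /allP h _; apply/negP => /h; rewrite /before; lia.
Qed.

Lemma legal_head e l p f : legal (e :: l) p -> f \in l -> before e f.
Proof.
move=> L; have := legal_sorted L; rewrite /= (path_sortedE before_trans).
by case/andP=> /allP h _ /h.
Qed.

Lemma legal_tail e l p f : legal (e :: l) p -> U f -> before e f -> f \in l.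
Proof.
move=> L Uf ef; have := legal_final L (mem_head _ _) Uf ef.
by rewrite inE => /orP[/eqP fe|//]; move: ef; rewrite fe /before; lia.
Qed.

Lemma legal_free e l p : legal (e :: l) p -> e \notin codom p -> legal l p.
Proof.
move=> L ep; split.
- by move: (legal_sorted L) => /= /path_sorted.
- by move=> f fl; apply: (legal_up L); rewrite inE fl orbT.
- move=> f g fl Ug fg; apply: (legal_tail L Ug).
  exact: before_trans (legal_head L fl) fg.
- exact: (legal_desc L).
- by move=> i j ij pl; apply: (legal_close L ij); rewrite inE pl orbT.
- move=> j; have := legal_pos L j; rewrite inE; case: eqP => //= pe.
  by case/negP: ep; rewrite -pe codom_f.
- by move=> f fl; apply: (legal_cover L); rewrite inE fl orbT.
Qed.

(** The down triangle at [e] is still free and its other two up neighbours precede [e] in the sweep,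
    so its partner can only be the up triangle at [e]. *)
Lemma remaining_free e l p : legal (e :: l) p -> e \notin codom p ->
  #|matchings adj (remaining (e :: l) p)| = #|matchings adj (remaining l p)|.
Proof.
move=> L ep; have el := legal_head_notin L.
have We : tri_of e true \in D.
  by apply/negPn/negP => nW; case/negP: ep; apply: (legal_cover L); rewrite ?mem_head.
have Ue : tri_of e false \in D by apply: (legal_up L); rewrite mem_head.
pose t0 : D := [` We]%fset; pose s0 : D := [` Ue]%fset.
have t0A : t0 \in remaining (e :: l) p by rewrite !inE /= tri_ofK mem_head.
have s0A : s0 \in remaining (e :: l) p by rewrite !inE /= tri_ofK mem_head.
have adj_sym : symmetric adj by move=> s t; apply: share_edge_sym.
have adj_irr : irreflexive adj.
  by move=> s; apply: share_edge_orient.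
rewrite (card_matchings_rec adj_sym adj_irr t0A) (big_pred1 s0); last first.
  move=> s; apply/andP/eqP => [[sA]|->]; last first.
    by rewrite adj_sym /adj share_edge_up //= !tri_ofK eqxx.
  rewrite adj_sym /adj; case o: (val s).2.
    by rewrite share_edge_orient.
  rewrite share_edge_up //= !tri_ofK => h; apply/eqP; rewrite eq_tri /= tri_ofK o eqxx andbT.
  move: sA h; rewrite !inE /= o => /orP[//|/(legal_head L)].
  case: (edge_of _) => a b; case: (e) => c d.
  by rewrite /before /stepW /stepSW !xpair_eqE /=; lia.
congr #|matchings _ _|; apply/setP => s; rewrite !inE !eq_tri /= !tri_ofK.
set f := edge_of _; rewrite in_cons; case: eqP => /= [fe|_]; last by case: (fsval s).2.
by rewrite fe (negPf el) (legal_up L) ?mem_head //=; case: (fsval s).2.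
Qed.

Lemma move_to_inj p j d : injective p -> d \notin codom p ->
  forall f, (f \in codom (move_to p j d)) = (f == d) || (f != p j) && (f \in codom p).
Proof.
move=> pI dp f; apply/codomP/orP => [[i]|].
  rewrite /move_to; case: eqP => [_ ->|ne ->]; [by left; rewrite eqxx|right].
  by rewrite codom_f andbT; apply/negP => /eqP /pI.
case=> [/eqP->|/andP[fj /codomP[i fi]]]; first by exists j; rewrite /move_to eqxx.
exists i; rewrite /move_to; case: eqP => // ij.
by rewrite fi ij eqxx in fj.
Qed.

Lemma legal_inj l p : legal l p -> injective p.
Proof.
move=> L i j e; apply: val_inj => /=.
case: (ltngtP i j) => // /(legal_desc L); by rewrite e ltxx.
Qed.

Lemma legal_step e l p j d : legal (e :: l) p -> p j = e ->
    (d = stepW e) \/ (d = stepSW e) -> W d -> d \notin codom p ->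
  legal l (move_to p j d).
Proof.
move=> L pj dE Wd dp; have el := legal_head_notin L.
have pI := legal_inj L.
have ed : before e d by case: dE => ->; rewrite /before /=; lia.
have dl : (d \in l) || (d \in codom ent).
  by case: (boolP (U d)) => [/(legal_tail L) -> //|/(entW Wd) ->]; rewrite orbT.
have Ue : U e by apply: (legal_up L); rewrite mem_head.
split.
- by move: (legal_sorted L) => /= /path_sorted.
- by move=> f fl; apply: (legal_up L); rewrite inE fl orbT.
- move=> f g fl Ug fg; apply: (legal_tail L Ug).
  exact: before_trans (legal_head L fl) fg.
- move=> i i' ii'; rewrite /move_to; case: (i =P j) => [ij|_].
    case: eqP => [i'j|_]; first by move: ii'; rewrite ij i'j ltnn.
    have := legal_desc L ii'; rewrite ij pj; case: dE => dE; first by rewrite dE.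
    (* Only a southwest move could break the order, by reaching the row of a lower particle [i'].
       That particle is at most one unit ahead by [legal_close], and at least one because it comes
       later in the sweep or is an exit; so it would sit on [d], which is free. *)
    have cl : (p i').1 >= e.1 - 1.
      by have := legal_close L ii'; rewrite ij pj mem_head => /(_ isT).
    have nd : p i' != d by apply/negP => /eqP h; case/negP: dp; rewrite -h codom_f.
    move=> lt; suff : (p i').2 != d.2 by rewrite dE /=; lia.
    apply/negP => /eqP e2.
    suff e1 : (p i').1 <= e.1 - 1.
      case/negP: nd; rewrite dE in e2 *; rewrite [p i']surjective_pairing.
      by rewrite /stepSW xpair_eqE; apply/andP; split; apply/eqP; move: e2 => /=; lia.
    have /orP[] := legal_pos L i'.
      rewrite inE => /orP[/eqP h|/(legal_head L)]; last first.
        by rewrite /before; move: e2; rewrite dE /=; lia.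
      by move: lt; rewrite h ltxx.
    case/codomP=> k hk; rewrite hk in e2 *; have := ent_lt (i := k) Ue; rewrite e2 dE /= subrK => /(_ erefl).
    lia.
  case: eqP => [i'j|_]; last exact: (legal_desc L).
  by have := legal_desc L ii'; rewrite i'j pj; case: dE => -> /=; lia.
- move=> i i' ii'; rewrite /move_to; case: (i =P j) => [ij|ij].
    case: eqP => [i'j|_]; first by move: ii'; rewrite ij i'j ltnn.
    have := legal_close L ii'; rewrite ij pj mem_head => /(_ isT).
    by case: dE => -> /=; lia.
  case: eqP => [i'j|_] pl; last by apply: (legal_close L ii'); rewrite inE pl orbT.
  have := legal_head L pl; rewrite /before.
  by case: dE => -> /=; lia.
- move=> i; rewrite /move_to; case: eqP => [//|ij].
  have := legal_pos L i; rewrite inE; case: (p i =P e) => //= h.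
  by case: ij; apply: pI; rewrite h pj.
- move=> f fl nW; rewrite (move_to_inj j pI dp) (legal_cover L) ?inE ?fl ?orbT // andbT.
  by rewrite pj; case: (f =P e) => [fe|]; rewrite ?orbT //; case/negP: el; rewrite -fe.
Qed.

(** The down triangle at [e] stays excluded: before because particle [j] is there, afterwards
    because [e] has left the list. *)
Lemma remaining_step e l p j d (s0 t0 : D) : legal (e :: l) p -> p j = e ->
    before e d -> val t0 = tri_of e false -> val s0 = tri_of d true ->
    d \notin codom p ->
  remaining (e :: l) p :\ t0 :\ s0 = remaining l (move_to p j d).
Proof.
move=> L pj ed t0E s0E dp; have el := legal_head_notin L.
have Ue : U e by apply: (legal_up L); rewrite mem_head.
apply/setP => s; rewrite !inE !eq_tri t0E s0E !tri_ofK /= (move_to_inj _ (legal_inj L) dp).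
set f := edge_of _; rewrite pj in_cons; case: (fsval s).2 => /=; last first.
  by rewrite !andbT andbF /=; case: eqP => [->|]; rewrite ?(negPf el).
rewrite !andbT andbF /= !negb_or negb_and negbK.
case: (f =P d) => //= fd; first by rewrite andbF.
case: (f =P e) => [->|_] //=.
by rewrite (negPf el) Ue -pj codom_f.
Qed.

Lemma big_val_pred1 (F : D -> nat) (A : {set D}) (s0 : D) : s0 \in A ->
  (\sum_(s in A | val s == val s0) F s = F s0)%N.
Proof.
move=> s0A; rewrite (big_pred1 s0) // => s /=.
by rewrite val_eqE; case: eqP => [->|]; rewrite ?andbF // andbT.
Qed.

Theorem card_remaining l p : legal l p ->
  #|matchings adj (remaining l p)|%:R = \det (path_mx p).
Proof.
elim: l p => [|e l IH] p L; first exact: card_remaining_nil.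
case: (boolP (e \in codom p)) => [/codomP[j pj]|ep]; last first.
  by rewrite remaining_free // IH //; apply: legal_free ep.
have Ue : tri_of e false \in D by apply: (legal_up L); rewrite mem_head.
pose t0 : D := [` Ue]%fset.
have t0A : t0 \in remaining (e :: l) p by rewrite !inE /= tri_ofK mem_head.
have adj_sym : symmetric adj by move=> s t; apply: share_edge_sym.
have adj_irr : irreflexive adj by move=> s; apply: share_edge_orient.
rewrite (card_matchings_rec adj_sym adj_irr t0A).
set A := remaining _ _ in t0A *; set F := fun s : D => #|matchings adj (A :\ t0 :\ s)|.
pose h d := (\sum_(s in A | val s == tri_of d true) F s)%N.
(* [h d] counts the completions with the particle moved to [d]. Both sides vanish if [d] has no down
   triangle in the region (zero row) or is occupied (two equal rows); otherwise induction
   applies. *)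
have hE d : (d = stepW e) \/ (d = stepSW e) ->
    (forall i, ~~ W d -> v i d = 0) -> (h d)%:R = \det (path_mx (move_to p j d)).
  move=> dE v0; case: (boolP (W d)) => [Wd|nW]; last first.
    rewrite /h big_pred0 => [|s]; last first.
      by apply/negP => /andP[_ /eqP sd]; case/negP: nW; rewrite /W -sd; exact: valP.
    rewrite (expand_det_row _ j) big1 // => i _.
    by rewrite mxE /move_to eqxx v0 ?mul0r.
  have ed : before e d by case: dE => ->; rewrite /before /=; lia.
  case: (boolP (d \in codom p)) => [/codomP[k pk]|dp].
    have kj : j != k.
      by apply/eqP => jk; move: ed; rewrite pk -jk pj /before; lia.
    rewrite (determinant_alternate kj) => [|i]; last first.
      by rewrite !mxE /move_to eqxx eq_sym (negPf kj) -pk.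
    rewrite /h big_pred0 // => s; apply/negP => /andP[+ /eqP sd].
    by rewrite !inE sd /= tri_ofK pk codom_f andbF.
  pose s0 : D := [` Wd]%fset.
  rewrite /h (_ : tri_of d true = val s0) // big_val_pred1; last first.
    rewrite !inE /= tri_ofK dp andbT; case: (boolP (U d)) => Ud; last by rewrite orbT.
    by rewrite in_cons (legal_tail L Ud ed) orbT.
  rewrite /F (@remaining_step e l p j d) // IH //.
  exact: (legal_step L (esym pj) dE Wd dp).
(* The third neighbour, the down triangle at [e], is already used by particle [j]. *)
have -> : (\sum_(s in A | adj t0 s) F s = h (stepW e) + h (stepSW e))%N.
  rewrite /h 3!big_mkcondr -big_split /=; apply: eq_bigr => s sA.
  rewrite /adj share_edge_up //= tri_ofK.
  have ts d : (val s == tri_of d true) = (val s).2 && (edge_of (val s) == d).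
    apply/eqP/andP => [->|[o /eqP <-]]; first by rewrite tri_ofK eqxx.
    by rewrite -[X in tri_of _ X]o edge_ofK.
  rewrite !ts; move: sA; rewrite !inE; case: (val s).2 => //= /andP[_].
  case: (edge_of (val s) =P e) => /= [->|ne]; first by rewrite pj codom_f.
  by case: eqP => [->|_] /= _; rewrite ?addn0 // xpair_eqE eqxx /=; case: eqP => //; lia.
rewrite natrD !hE; try by [left|right].
- symmetry; rewrite -[\det (path_mx (move_to _ _ _))]mul1r.
  rewrite -[X in _ + X]mul1r; apply: (@determinant_multilinear _ _ _ _ _ j).
  + by apply/rowP => i; rewrite !mxE /move_to eqxx -pj !mul1r; apply: v_rec.
  + by apply/matrixP => a b; rewrite !mxE /move_to eq_sym (negPf (neq_lift _ _)).
  + by apply/matrixP => a b; rewrite !mxE /move_to eq_sym (negPf (neq_lift _ _)).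
- by move=> i; apply: v_SW.
- by move=> i; apply: v_W.
Qed.

End Peeling.

(** * The region *)

Section RegionMembership.

Variables (a b : int) (down : bool).

(** Half of [s] is the western end of the segment that the triangle cuts from the middle line of row
    [b]. *)
Let s : int := 2 * a + down%:R.
Let crossings p ds := count (crosses_west (a, b, down)) (edges p ds).

Lemma crossings_cons p d ds : crossings p (d :: ds) =
  ((p.2 + (p.2 + d.2) == 2 * b + 1)%R && (p.1 + (p.1 + d.1) <= s)%R
   + crossings (p + d)%R ds)%N.
Proof. by []. Qed.

Lemma crossings_cat p ds1 ds2 : crossings p (ds1 ++ ds2) =
  (crossings p ds1 + crossings (p + \sum_(d <- ds1) d)%R ds2)%N.
Proof. by rewrite /crossings edges_cat count_cat. Qed.

Lemma crossings_horizontal p k d : d.2 = 0 -> crossings p (nseq k d) = 0%N.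
Proof.
move=> d0; elim: k p => [|k IH] p; first by rewrite /crossings.
rewrite [nseq _ _]/= crossings_cons IH d0 addr0 addn0.
by case: eqP => //=; lia.
Qed.

(** Each row is crossed at most once, hence the boolean; the crossing in row [b] comes after
    [q - 1 - b] pairs of steps, each raising the first coordinate by two. *)
Lemma crossings_northeast p q k :
  crossings (p, q) (northeastern_side k) =
  ((q - k%:Z <= b < q) && (2 * p + 4 * (q - 1 - b) + 1 <= s)) :> nat.
Proof.
rewrite /northeastern_side; elim: k p q => [|k IH] p q.
  by rewrite /crossings /=; case: andP => // -[/andP[]]; lia.
rewrite [flatten _]/= !crossings_cons /= IH.
have -> : q + (q - 1) == 2 * b + 1 = (b == q - 1) by lia.
have -> : q - 1 + (q - 1 + 0) == 2 * b + 1 = false by lia.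
case: eqP => [->|ne] /=.
  have -> : (q - 1 + 0 - k%:Z <= q - 1 < q - 1 + 0) = false by lia.
  rewrite ?addn0; congr nat_of_bool; lia.
rewrite ?add0n; congr nat_of_bool; lia.
Qed.

Lemma crossings_southeast p q k :
  crossings (p, q) (southeastern_side k) =
  ((q - k%:Z <= b < q) && (2 * p <= s)) :> nat.
Proof.
rewrite /southeastern_side; elim: k p q => [|k IH] p q.
  by rewrite /crossings /=; case: andP => // -[/andP[]]; lia.
rewrite [nseq _ _]/= !crossings_cons /= IH.
have -> : q + (q - 1) == 2 * b + 1 = (b == q - 1) by lia.
case: eqP => [->|ne] /=.
  have -> : (q - 1 - k%:Z <= q - 1 < q - 1) = false by lia.
  rewrite ?addn0; congr nat_of_bool; lia.
rewrite ?add0n; congr nat_of_bool; lia.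
Qed.

Lemma crossings_west p q k :
  crossings (p, q) (rev (map -%R (western_side k))) =
  ((q <= b < q + 2 * k%:Z) && (2 * p - (b - q) <= s)) :> nat.
Proof.
rewrite /western_side map_flatten map_nseq rev_flatten map_nseq rev_nseq.
elim: k p q => [|k IH] p q.
  by rewrite /crossings /=; case: andP => // -[/andP[]]; lia.
rewrite [flatten _]/= !crossings_cons /= IH.
have -> : q + (q + - - 1) == 2 * b + 1 = (b == q) by lia.
have -> : q + - - 1 + (q + - - 1 + - - 1) == 2 * b + 1 = (b == q + 1) by lia.
case: eqP => [->|ne] /=.
  have -> : (q == q + 1) = false by lia.
  have -> : (q + - - 1 + - - 1 <= q < q + - - 1 + - - 1 + 2 * k%:Z) = false by lia.
  rewrite ?addn0; congr nat_of_bool; lia.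
case: eqP => [->|ne'] /=.
  have -> : (q + - - 1 + - - 1 <= q + 1 < q + - - 1 + - - 1 + 2 * k%:Z) = false by lia.
  rewrite ?addn0; congr nat_of_bool; lia.
rewrite ?add0n; congr nat_of_bool; lia.
Qed.

(** Each row meets the western side once and the eastern boundary once, on the northeastern side if
    [n <= b] and on the southeastern one otherwise. Odd parity means lying between these two
    crossings. *)
Lemma in_C_region n x : ((a, b, down) \in C_region n x) =
  [&& 0 <= b, b < 2 * n%:Z, 2 * n%:Z - b <= s
    & s < if n%:Z <= b then 2 * x%:Z + 8 * n%:Z - 4 * b - 3 else 2 * x%:Z + 4 * n%:Z].
Proof.
rewrite mem_C_region /enclosed -/(crossings _ _) /C_boundary.
have nseqE k (d : vertex) : \sum_(e <- nseq k d) e = (d.1 * k%:Z, d.2 * k%:Z).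
  elim: k => [|k IHk] /=; first by rewrite big_nil !mulr0.
  by rewrite big_cons IHk; case: d {IHk} => d1 d2; congr (_, _) => /=; lia.
have neE : \sum_(d <- northeastern_side n) d = ((2 * n)%N%:Z, - n%:Z).
  rewrite /northeastern_side; elim: n => [|n IHn] /=; first by rewrite big_nil.
  by rewrite !big_cons IHn; congr (_, _) => /=; lia.
rewrite !crossings_cat (@crossings_horizontal _ x dir0) // (@crossings_horizontal _ _ (- dir0)) // !add0n nseqE neE /southeastern_side !nseqE.
rewrite -/(southeastern_side n) /C_start crossings_northeast crossings_southeast crossings_west /=.
rewrite !oddD !oddb.
case: (lerP n%:Z b) => h; lia.
Qed.

End RegionMembership.

(** * Binomial coefficients and Pascal's rule *)

Lemma prod_natr_sub (R : comNzRingType) (N k : nat) :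
  \prod_(i < k) (N%:R - i%:R : R) = (N ^_ k)%:R.
Proof.
elim: k => [|k IH]; first by rewrite big_ord0 ffactn0.
rewrite big_ord_recr /= IH ffactnSr natrM.
by case: (leqP k N) => [kN|Nk]; [rewrite natrB | rewrite ffact_small // !mul0r].
Qed.

Lemma gbinom_nat (N k : nat) : gbinom (N%:R : rat) k = 'C(N, k)%:R.
Proof.
rewrite /gbinom prod_natr_sub -bin_ffact natrM mulfK //.
by rewrite pnatr_eq0 -lt0n fact_gt0.
Qed.

Definition binz (m k : int) : rat :=
  match m, k with Posz m, Posz k => 'C(m, k)%:R | _, _ => 0 end.

(** With the extension by zero, Pascal's rule fails only at the origin, where it would read
    [1 = 0]. *)
Lemma binz_rec m k : (m, k) != (0, 0) ->
  binz m k = binz (m - 1) k + binz (m - 1) (k - 1).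
Proof.
case: m k => [[|m]|m] [[|k]|k] // _.
- by rewrite /binz /= subn1 /= !bin0 addr0.
- have -> : m.+1%:Z - 1 = m by lia.
  have -> : k.+1%:Z - 1 = k by lia.
  by rewrite /binz binS natrD.
Qed.

Lemma binz_eq0 m k : [|| m < 0, k < 0 | m < k] -> binz m k = 0.
Proof. by case: m k => [m|m] [k|k] //= h; rewrite bin_small //; lia. Qed.

(** * Tilings of the pentagon as lozenge paths *)

Section TriangularRegion.

Variables n x : nat.

Let D := C_region n x.

(* Where the lozenge paths leave the region through the western side and
   enter it through the northeastern one. *)
Definition west_end (i : 'I_n) : int * int :=
  (2 * n%:Z - i%:Z, 2 * n%:Z - 2 * i%:Z - 1).
Definition east_end (j : 'I_n) : int * int :=
  (x%:Z + 2 * n%:Z + j%:Z, 2 * n%:Z - j%:Z - 1).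

(** A path from [e] makes [e.1 - (west_end i).1] steps, of which [e.2 - (west_end i).2] go
    southwest. *)
Definition path_count (i : 'I_n) (e : int * int) : rat :=
  binz (e.1 - (west_end i).1) (e.2 - (west_end i).2).

(** Sorting uses the reflexive closure of [before], which is total; strictness is recovered from the
    absence of duplicates. *)
Definition up_edges : seq (int * int) :=
  sort (fun e f => before e f || (e == f)) [seq edge_of t | t <- D & ~~ t.2].

Lemma mem_up_edges e : (e \in up_edges) = (tri_of e false \in D).
Proof.
rewrite mem_sort; apply/mapP/idP => [[t]|eD].
  rewrite mem_filter => /andP[+ tD] ->.
  by rewrite -{1}(edge_ofK t) in tD *; case: t.2 tD.
by exists (tri_of e false); rewrite ?mem_filter ?tri_ofK.
Qed.

Lemma up_edges_sorted : sorted before up_edges.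
Proof.
have -> : sorted before up_edges =
    pairwise [rel e f | (before e f || (e == f)) && (e != f)] up_edges.
  rewrite (sorted_pairwise before_trans); apply: eq_pairwise => -[a b] [c d] /=.
  by rewrite /before xpair_eqE /=; lia.
rewrite (pairwise_relI (fun e f => before e f || (e == f)) (fun e f => e != f)).
rewrite -uniq_pairwise sort_uniq map_inj_in_uniq ?filter_uniq ?fset_uniq ?andbT //; last first.
  move=> t t'; rewrite !mem_filter => /andP[ht _] /andP[ht' _] e.
  by rewrite -(edge_ofK t) -(edge_ofK t') e (negPf ht) (negPf ht').
rewrite -sorted_pairwise; last first.
  by move=> [a b] [c d] [e f]; rewrite /before !xpair_eqE /=; lia.
apply: sort_sorted => -[a b] [c d]; rewrite /before !xpair_eqE /=; lia.
Qed.

Let inD := (in_C_region, mem_up_edges).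

Lemma legal_east_end : legal D west_end up_edges east_end.
Proof.
split.
- exact: up_edges_sorted.
- by move=> e; rewrite mem_up_edges.
- by move=> e f _ Uf _; rewrite mem_up_edges.
- by move=> i j ij /=; lia.
- by move=> i j ij _ /=; lia.
- move=> j; have jn := ltn_ord j.
  (* When [x = 0], particle [0] starts on its exit, an edge without an up triangle in the region. *)
  have [xj|xj] := posnP (x + j); apply/orP; [right|left]; last first.
    by rewrite !inD /=; case: ifP; lia.
  by apply/codomP; exists j; rewrite /east_end /west_end; congr (_, _); lia.
- move=> [t b]; rewrite !inD /= => h1 h2.
  have jn : (`|(2 * n%:Z - 1 - b)%R| < n)%N by move: h1 h2; case: ifP; lia.
  apply/codomP; exists (Ordinal jn); rewrite /east_end /=.
  by congr (_, _); move: h1 h2; case: ifP; lia.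
Qed.

(** The down triangles at the starting edges lie outside the region, so no triangle is used up
    yet. *)
Lemma remaining_east_end : remaining D up_edges east_end = [set: D].
Proof.
apply/setP => s; rewrite !inE; set e := edge_of _.
have sD : tri_of e (val s).2 \in D by rewrite edge_ofK; apply: valP.
rewrite /e; case: (fsval s).2 sD => sD; last by rewrite mem_up_edges.
rewrite mem_up_edges orbN /=; apply/codomP => -[j ej].
move: sD; rewrite /e ej in_C_region /=.
by have := ltn_ord j; case: ifP; lia.
Qed.

Lemma card_tilings_path_mx :
  #|lozenge_tilings D|%:R = \det (path_mx path_count east_end).
Proof.
rewrite -(@card_remaining _ D _ west_end path_count _ _ _ _ _ _ _ up_edges).
- by rewrite remaining_east_end.
- move=> [t b]; rewrite !inD /= => h1 h2.
  have jn : (`|(t - b - 1)%R| < n)%N by move: h1 h2; case: ifP; lia.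
  apply/codomP; exists (Ordinal jn); rewrite /west_end /=.
  by congr (_, _); move: h1 h2; case: ifP; lia.
- move=> i [t b]; rewrite !inD /= => h1 h2; have := ltn_ord i.
  by move: h1; case: ifP; lia.
- by move=> i j ij /=; lia.
- move=> i [t b]; rewrite !inD /= => h; rewrite /path_count binz_rec /=.
    by congr (binz _ _ + binz _ _); lia.
  (* The exceptional case of Pascal's rule is the exit itself, which carries no up triangle. *)
  rewrite xpair_eqE; have := ltn_ord i; move: h; case: ifP; lia.
- move=> i [t b]; rewrite !inD /= => h1 h2; apply: binz_eq0 => /=.
  by move: h1 h2; case: ifP; lia.
- move=> i [t b]; rewrite !inD /= => h1 h2; apply: binz_eq0 => /=.
  by have := ltn_ord i; move: h1 h2; case: ifP; case: ifP; lia.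
- move=> i j; have [<-|ij] := eqVneq i j; first by rewrite /path_count !subrr.
  apply: binz_eq0 => /=; have : (i != j :> nat) by [].
  lia.
- exact: legal_east_end.
Qed.

End TriangularRegion.

Theorem card_lozenge_tilings n x :
  #|lozenge_tilings (C_region n x)|%:R = \det (binom_mx n (x%:R : rat)).
Proof.
rewrite card_tilings_path_mx; congr (\det _); apply/matrixP => i j.
rewrite !mxE /path_count /= -!natrD.
have -> : x%:Z + 2 * n%:Z + i%:Z - (2 * n%:Z - j%:Z) = (x + i + j)%N by lia.
have -> : 2 * n%:Z - i%:Z - 1 - (2 * n%:Z - 2 * j%:Z - 1) = 2 * j%:Z - i%:Z by lia.
by case: (2 * _ - _) => k //; rewrite gbinom_nat.
Qed.

(** * The recurrence *)

(** At negative integers this is a nonzero placeholder, hence the condition in [factzS]; the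
    vanishing of terms always comes from [rfactz]. *)
Definition factz (m : int) : rat := (factorial `|m|)%:R.

(* The reciprocal factorial, which vanishes at negative integers. *)
Definition rfactz (m : int) : rat :=
  if m is Posz k then (k`!)%:R^-1 else 0.

Lemma factzS m : 0 <= m -> factz (m + 1) = (m%:~R + 1) * factz m.
Proof.
case: m => // m _; rewrite /factz; have -> : `|(m%:Z + 1)%R|%N = m.+1 by lia.
by rewrite factS natrM -natr1.
Qed.

Lemma rfactzP m : rfactz (m - 1) = m%:~R * rfactz m.
Proof.
case: m => [[|m]|m]; [by rewrite mul0r| |by rewrite mulr0].
have -> : m.+1%:Z - 1 = m by lia.
rewrite /rfactz factS natrM invfM mulrA divff ?mul1r //.
by rewrite pnatr_eq0.
Qed.

Lemma factz_neq0 m : factz m != 0.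
Proof. by rewrite pnatr_eq0 -lt0n fact_gt0. Qed.

Lemma rfactz_neq0 m : 0 <= m -> rfactz m != 0.
Proof. by case: m => // m _; rewrite invr_eq0 pnatr_eq0 -lt0n fact_gt0. Qed.

(* The coefficients of the recurrence in (n, j) satisfied by [alt_sum] and,
   with [cert0], [cert1], [cert2], its Zeilberger certificate; they come from
   Gosper's algorithm, by solving a linear system. *)
Definition rec_diag (n x j : rat) : rat :=
  2 * (2 * j + 1) * (x + 3 * j + 1) * (x + 3 * j + 2)
  * (2 * x + 2 * n + 2 * j + 5) * (2 * x + 4 * n + 3).

Definition rec_right (n x j : rat) : rat := - (x - j + 2 * n + 2) * (
  (((216 * n + 540 * x + 324 * j + 972) * n + (504 * x + 648 * j + 1836) * x
  + (216 * j + 1188) * j + 1650) * n + ((208 * x + 428 * j + 1150) * x +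
  (300 * j + 1584) * j + 2093) * x + ((72 * j + 558) * j + 1447) * j + 1253)
  * n + (((32 * x + 92 * j + 238) * x + (96 * j + 510) * j + 655) * x + ((36
  * j + 342) * j + 928) * j + 791) * x + ((54 * j + 297) * j + 555) * j +
  354).

Definition rec_up (n x j : rat) : rat :=
  (x + j + 2 * n + 2) * (x + j + 2 * n + 1)
  * (2 * x + 6 * n + 5) * (2 * x + 6 * n + 3) * (2 * x + 6 * n + 1).

Definition cert0 (n x j : rat) : rat :=
  ((((- 32 * x - 288 * j - 192) * x + 96 * j + 32) * n + ((- 48 * x - 464 *
  j - 376) * x + (- 288 * j - 840) * j - 480) * x + (96 * j + 296) * j + 88)
  * n + (((- 16 * x - 192 * j - 200) * x + (- 176 * j - 832) * j - 552) * x
  + (- 344 * j - 720) * j - 392) * x + (120 * j + 256) * j + 72) * n + ((((-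
  16 * j - 24) * x + (- 16 * j - 152) * j - 128) * x + (- 112 * j - 356) * j
  - 218) * x + (- 108 * j - 202) * j - 108) * x + (36 * j + 66) * j + 18.

Definition cert1 (n x j : rat) : rat :=
  (((48 * x - 432 * j - 336) * n + (72 * x - 600 * j - 372) * x + (- 432 * j
  - 1524) * j - 924) * n + ((56 * x - 144 * j - 44) * x + (- 168 * j - 1144)
  * j - 728) * x + (- 636 * j - 1552) * j - 820) * n + (((16 * x + 24 * j +
  44) * x + (24 * j - 92) * j - 76) * x + (- 120 * j - 518) * j - 317) * x +
  (- 234 * j - 489) * j - 237.

Definition cert2 (n x j : rat) : rat :=
  ((144 * n + 216 * x + 144 * j + 396) * n + (120 * x + 216 * j + 436) * x +
  (144 * j + 372) * j + 388) * n + ((24 * x + 72 * j + 128) * x + (72 * j +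
  240) * j + 224) * x + (108 * j + 198) * j + 129.

Definition cert (n x j k : rat) : rat :=
  cert0 n x j + cert1 n x j * k + cert2 n x j * k ^+ 2.

(** [gosper_num / gosper_den] is the ratio of the values of [common_row n k * common_entry k j] at
    [k + 1] and at [k]. *)
Definition gosper_num (n x j k : rat) : rat :=
  - 2 * (2 * x + 2 * n + 2 * k + 1) * (x + k + 1) * (x + j + k + 1)
  * (n + 1 - k) * (2 * j + 2 - k).

Definition gosper_den (n x j k : rat) : rat :=
  (2 * n - k - 1) * k * (2 * x + 2 * n + k + 4)
  * (x - j + 2 * k + 2) * (x - j + 2 * k + 1).

(** The telescoping identity for the summand of [alt_sum_rec], divided by twice
    [common_row n k * common_entry k j]. *)
Lemma gosper_equation n x j k :
  rec_diag n x j * ((2 * x + 2 * n + 2 * k + 1) * (2 * n - k + 1)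
    * (2 * n - k) * (x + j + k + 1) * (x - j + 2 * k))
  + rec_right n x j * ((2 * x + 2 * n + 2 * k + 1) * (2 * n - k + 1)
    * (2 * n - k) * (2 * j + 2 - k) * (2 * j + 1 - k))
  + rec_up n x j * ((n + 1 - k) * (2 * x + 2 * n + k + 3)
    * (2 * x + 2 * n + k + 2) * (2 * j + 2 - k) * (2 * j + 1 - k))
  = gosper_num n x j k * cert n x j (k + 1)
    - gosper_den n x j (k - 1) * cert n x j k.
Proof.
rewrite /rec_diag /rec_right /rec_up /cert /cert0 /cert1 /cert2.
rewrite /gosper_num /gosper_den.
ring.
Qed.

Section Recurrence.

Variable x : nat.

(* The coefficients of a row operation that makes the matrix triangular. *)
Definition row_coef (n k : nat) : rat :=
  (- 1) ^+ k * factz (2 * x%:Z + 2 * n%:Z + 2 * k%:Z) * factz (x%:Z + k%:Z)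
  * factz (2 * n%:Z - k%:Z - 1) * rfactz (x%:Z + n%:Z + k%:Z)
  * rfactz (k%:Z - 1) * rfactz (n%:Z - k%:Z)
  * rfactz (2 * x%:Z + 2 * n%:Z + k%:Z + 1).

(** The binomial coefficient in row [k], column [j], written with factorials; [rfactz] supplies its
    zeros. *)
Definition entry (k j : nat) : rat :=
  factz (x%:Z + j%:Z + k%:Z) * rfactz (2 * j%:Z - k%:Z)
  * rfactz (x%:Z - j%:Z + 2 * k%:Z).

Definition alt_sum (n j : nat) : rat :=
  \sum_(1 <= k < n.+1) row_coef n k * entry k j.

(** A common factor of [row_coef n k] and [row_coef n.+1 k] with polynomial cofactors;
    [common_entry] does the same for columns [j] and [j.+1]. *)
Definition common_row (n k : nat) : rat :=
  (- 1) ^+ k * factz (2 * x%:Z + 2 * n%:Z + 2 * k%:Z) * factz (x%:Z + k%:Z)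
  * factz (2 * n%:Z - k%:Z - 1) * rfactz (x%:Z + n%:Z + k%:Z)
  * rfactz (k%:Z - 1) * rfactz (n%:Z + 1 - k%:Z)
  * rfactz (2 * x%:Z + 2 * n%:Z + k%:Z + 3).

Definition common_entry (k j : nat) : rat :=
  factz (x%:Z + j%:Z + k%:Z) * rfactz (2 * j%:Z + 2 - k%:Z)
  * rfactz (x%:Z - j%:Z + 2 * k%:Z).

Lemma factz_shift a b : a = b + 1 -> 0 <= b -> factz a = (b%:~R + 1) * factz b.
Proof. by move=> ->; apply: factzS. Qed.

Lemma rfactz_shift a b : a = b - 1 -> rfactz a = b%:~R * rfactz b.
Proof. by move=> ->; apply: rfactzP. Qed.

Lemma row_coefE n k : row_coef n k = common_row n k * ((n%:R + 1 - k%:R)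
  * (2 * x%:R + 2 * n%:R + k%:R + 3) * (2 * x%:R + 2 * n%:R + k%:R + 2)).
Proof.
rewrite /row_coef /common_row.
rewrite (@rfactz_shift (n%:Z - k%:Z) (n%:Z + 1 - k%:Z)); last by lia.
rewrite (@rfactz_shift (2 * x%:Z + 2 * n%:Z + k%:Z + 1)
  (2 * x%:Z + 2 * n%:Z + k%:Z + 2)); last by lia.
rewrite (@rfactz_shift (2 * x%:Z + 2 * n%:Z + k%:Z + 2)
  (2 * x%:Z + 2 * n%:Z + k%:Z + 3)); last by lia.
by ring.
Qed.

Lemma row_coefSE n k : (k < 2 * n)%N -> row_coef n.+1 k = common_row n k *
  (2 * (2 * x%:R + 2 * n%:R + 2 * k%:R + 1) * (2 * n%:R - k%:R + 1)
  * (2 * n%:R - k%:R)).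
Proof.
move=> kn; rewrite /row_coef /common_row.
rewrite (@factz_shift (2 * x%:Z + 2 * n.+1%:Z + 2 * k%:Z)
  (2 * x%:Z + 2 * n%:Z + 2 * k%:Z + 1)); try by lia.
rewrite (@factz_shift (2 * x%:Z + 2 * n%:Z + 2 * k%:Z + 1)
  (2 * x%:Z + 2 * n%:Z + 2 * k%:Z)); try by lia.
rewrite (@factz_shift (2 * n.+1%:Z - k%:Z - 1) (2 * n%:Z - k%:Z)); try by lia.
rewrite (@factz_shift (2 * n%:Z - k%:Z) (2 * n%:Z - k%:Z - 1)); try by lia.
rewrite (@rfactz_shift (x%:Z + n%:Z + k%:Z) (x%:Z + n.+1%:Z + k%:Z)); last by lia.
have -> : n.+1%:Z - k%:Z = n%:Z + 1 - k%:Z by lia.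
have -> : 2 * x%:Z + 2 * n.+1%:Z + k%:Z + 1 = 2 * x%:Z + 2 * n%:Z + k%:Z + 3 by lia.
by ring.
Qed.

Lemma entryE k j :
  entry k j = common_entry k j * ((2 * j%:R + 2 - k%:R) * (2 * j%:R + 1 - k%:R)).
Proof.
rewrite /entry /common_entry.
rewrite (@rfactz_shift (2 * j%:Z - k%:Z) (2 * j%:Z + 1 - k%:Z)); last by lia.
rewrite (@rfactz_shift (2 * j%:Z + 1 - k%:Z) (2 * j%:Z + 2 - k%:Z)); last by lia.
by ring.
Qed.

Lemma entrySE k j : entry k j.+1 =
  common_entry k j * ((x%:R + j%:R + k%:R + 1) * (x%:R - j%:R + 2 * k%:R)).
Proof.
rewrite /entry /common_entry.
rewrite (@factz_shift (x%:Z + j.+1%:Z + k%:Z) (x%:Z + j%:Z + k%:Z)); try by lia.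
rewrite (@rfactz_shift (x%:Z - j.+1%:Z + 2 * k%:Z) (x%:Z - j%:Z + 2 * k%:Z));
  last by lia.
have -> : 2 * j.+1%:Z - k%:Z = 2 * j%:Z + 2 - k%:Z by lia.
by ring.
Qed.

Lemma common_rowS n k : (0 < k <= n.+1)%N -> (1 < n)%N ->
  common_row n k.+1 * ((2 * n%:R - k%:R - 1) * k%:R * (2 * x%:R + 2 * n%:R + k%:R + 4)) =
  common_row n k * (- 2 * (2 * x%:R + 2 * n%:R + 2 * k%:R + 1) * (x%:R + k%:R + 1)
   * (n%:R + 1 - k%:R)).
Proof.
move=> /andP[k0 kn] n1; rewrite /common_row exprS.
rewrite (@factz_shift (2 * x%:Z + 2 * n%:Z + 2 * k.+1%:Z)
  (2 * x%:Z + 2 * n%:Z + 2 * k%:Z + 1)); try by lia.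
rewrite (@factz_shift (2 * x%:Z + 2 * n%:Z + 2 * k%:Z + 1)
  (2 * x%:Z + 2 * n%:Z + 2 * k%:Z)); try by lia.
rewrite (@factz_shift (x%:Z + k.+1%:Z) (x%:Z + k%:Z)); try by lia.
rewrite (@rfactz_shift (x%:Z + n%:Z + k%:Z) (x%:Z + n%:Z + k.+1%:Z)); last by lia.
rewrite (@rfactz_shift (k%:Z - 1) (k.+1%:Z - 1)); last by lia.
rewrite (@rfactz_shift (n%:Z + 1 - k.+1%:Z) (n%:Z + 1 - k%:Z)); last by lia.
rewrite (@rfactz_shift (2 * x%:Z + 2 * n%:Z + k%:Z + 3)
  (2 * x%:Z + 2 * n%:Z + k.+1%:Z + 3)); last by lia.
(* At [k = n.+1] the shift of [factz] may reach a negative argument, but there both sides contain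
   the zero factor [n + 1 - k]. *)
have [->|kn'] := eqVneq k n.+1; first by ring.
rewrite (@factz_shift (2 * n%:Z - k%:Z - 1) (2 * n%:Z - k.+1%:Z - 1)); try by lia.
by ring.
Qed.

Lemma common_entryS k j :
  common_entry k.+1 j * ((x%:R - j%:R + 2 * k%:R + 2) * (x%:R - j%:R + 2 * k%:R + 1)) =
  common_entry k j * ((x%:R + j%:R + k%:R + 1) * (2 * j%:R + 2 - k%:R)).
Proof.
rewrite /common_entry.
rewrite (@factz_shift (x%:Z + j%:Z + k.+1%:Z) (x%:Z + j%:Z + k%:Z)); try by lia.
rewrite (@rfactz_shift (x%:Z - j%:Z + 2 * k%:Z) (x%:Z - j%:Z + 2 * k%:Z + 1));
  last by lia.
rewrite (@rfactz_shift (x%:Z - j%:Z + 2 * k%:Z + 1) (x%:Z - j%:Z + 2 * k.+1%:Z));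
  last by lia.
rewrite (@rfactz_shift (2 * j%:Z + 2 - k.+1%:Z) (2 * j%:Z + 2 - k%:Z)); last by lia.
by ring.
Qed.

Lemma alt_sum_rec n j : (1 < n)%N ->
  rec_diag n%:R x%:R j%:R * alt_sum n.+1 j.+1
  + rec_right n%:R x%:R j%:R * alt_sum n.+1 j
  + 2 * rec_up n%:R x%:R j%:R * alt_sum n j = 0.
Proof.
move=> n1.
(* [G] is the antidifference in [k] of the summand, built from the certificate. *)
pose G k := 2 * gosper_den n%:R x%:R j%:R (k%:R - 1) * cert n%:R x%:R j%:R k%:R
  * (common_row n k * common_entry k j).
have top : row_coef n n.+1 = 0 by rewrite row_coefE -(natr1 n) subrr !mul0r mulr0.
have -> : alt_sum n j = \sum_(1 <= k < n.+2) row_coef n k * entry k j.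
  by rewrite big_nat_recr //= top mul0r addr0.
rewrite /alt_sum !mulr_sumr -!big_split /=.
transitivity (\sum_(1 <= k < n.+2) (G k.+1 - G k)).
  apply: eq_big_nat => k /andP[k0 kn].
  have hg := gosper_equation n%:R x%:R j%:R k%:R.
  have hre : common_row n k.+1 * common_entry k.+1 j * gosper_den n%:R x%:R j%:R k%:R =
      common_row n k * common_entry k j * gosper_num n%:R x%:R j%:R k%:R.
    have he := common_entryS k j.
    have hr : common_row n k.+1 * _ = _ := common_rowS (introT andP (conj k0 kn)) n1.
    rewrite [RHS](_ : _ = common_row n k * (- 2 * (2 * x%:R + 2 * n%:R + 2 * k%:R + 1)
        * (x%:R + k%:R + 1) * (n%:R + 1 - k%:R))
      * (common_entry k j * ((x%:R + j%:R + k%:R + 1) * (2 * j%:R + 2 - k%:R)))).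
      by rewrite -hr -he /gosper_den; ring.
    by rewrite /gosper_num; ring.
  rewrite /G -(natr1 k) addrK row_coefSE ?row_coefE ?entrySE ?entryE; last by lia.
  transitivity (2 * (common_row n k * common_entry k j) *
    (gosper_num n%:R x%:R j%:R k%:R * cert n%:R x%:R j%:R (k%:R + 1)
     - gosper_den n%:R x%:R j%:R (k%:R - 1) * cert n%:R x%:R j%:R k%:R)).
    rewrite -hg.
    move: (rec_diag _ _ _) (rec_right _ _ _) (rec_up _ _ _) => a b c.
    by ring.
  move: hre; move: (gosper_num _ _ _ _) (cert _ _ _ _) (cert _ _ _ _) => g y' y hre.
  by ring: hre.
(* Both boundary terms vanish: [G 1] by the factor [k] of [gosper_den] at [0], and [G n.+2] by a
   reciprocal factorial at [-1]. *)
rewrite telescope_sumr // /G subrr.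
have -> : common_row n n.+2 = 0.
  by rewrite /common_row (_ : n%:Z + 1 - n.+2%:Z = - 1) ?mulr0 ?mul0r //; lia.
by rewrite /gosper_den !(mulr0, mul0r) subrr.
Qed.

End Recurrence.

(** * Triangular form of the binomial matrix *)

Section Triangularization.

Variable x : nat.

Lemma alt_sum0 n : alt_sum x n 0 = 0.
Proof.
rewrite /alt_sum big_nat_cond big1 // => -[//|k] _.
have -> : entry x k.+1 0 = 0; last by rewrite mulr0.
rewrite /entry; have -> : 2 * 0%N%:Z - k.+1%:Z = Negz k by rewrite NegzE; lia.
by rewrite mulr0 mul0r.
Qed.

Lemma row_coef_gt n k : (n < k)%N -> row_coef x n k = 0.
Proof.
move=> nk; rewrite /row_coef; have : n%:Z - k%:Z < 0 by lia.
by case: (n%:Z - k%:Z) => // m _; rewrite !(mulr0, mul0r).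
Qed.

Lemma row_coef_diag_neq0 n : row_coef x n.+1 n.+1 != 0.
Proof.
rewrite /row_coef !mulf_neq0 ?factz_neq0 ?rfactz_neq0 ?expf_neq0 //; lia.
Qed.

Lemma factzK m : 0 <= m -> factz m * rfactz m = 1.
Proof. by case: m => // m _; rewrite mulfV // factz_neq0. Qed.

(** This and the next evaluations settle [n = 1] and [n = 2], from which the recurrence starts. *)
Lemma entry11 : entry x 1 1 = x%:R + 2.
Proof.
rewrite /entry (@factz_shift (x%:Z + 1%N%:Z + 1%N%:Z) (x%:Z + 1)); try by lia.
have -> : x%:Z - 1%N%:Z + 2 * 1%N%:Z = x%:Z + 1 by lia.
have -> : rfactz (2 * 1%N%:Z - 1%N%:Z) = 1 by rewrite /rfactz /= invr1.
rewrite mulr1 -mulrA factzK; [ring | lia].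
Qed.

Lemma entry21 : entry x 2 1 = 1.
Proof.
rewrite /entry; have -> : x%:Z - 1%N%:Z + 2 * 2%N%:Z = x%:Z + 1%N%:Z + 2%N%:Z by lia.
have -> : rfactz (2 * 1%N%:Z - 2%N%:Z) = 1 by rewrite /rfactz /= invr1.
by rewrite mulr1 factzK //; lia.
Qed.

Lemma entry12 : 6 * entry x 1 2 = (x%:R + 3) * (x%:R + 2) * (x%:R + 1).
Proof.
rewrite /entry (@factz_shift (x%:Z + 2%N%:Z + 1%N%:Z) (x%:Z + 2)); try by lia.
rewrite (@factz_shift (x%:Z + 2) (x%:Z + 1)); try by lia.
rewrite (@factz_shift (x%:Z + 1) x%:Z); try by lia.
have -> : x%:Z - 2%N%:Z + 2 * 1%N%:Z = x%:Z by lia.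
have -> : rfactz (2 * 2%N%:Z - 1%N%:Z) = 6^-1 by [].
have := @factzK x isT; move: (factz x) (rfactz x) => a b ab.
by field: ab.
Qed.

Lemma entry22 : 2 * entry x 2 2 = (x%:R + 4) * (x%:R + 3).
Proof.
rewrite /entry (@factz_shift (x%:Z + 2%N%:Z + 2%N%:Z) (x%:Z + 3)); try by lia.
rewrite (@factz_shift (x%:Z + 3) (x%:Z + 2)); try by lia.
have -> : x%:Z - 2%N%:Z + 2 * 2%N%:Z = x%:Z + 2 by lia.
have -> : rfactz (2 * 2%N%:Z - 2%N%:Z) = 2^-1 by [].
have := @factzK (x%:Z + 2) isT; move: (factz (_ + 2)) (rfactz (_ + 2)) => a b ab.
by field: ab.
Qed.

Lemma row_coef2 : row_coef x 2 1 * (x%:R + 2) = - row_coef x 2 2.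
Proof.
rewrite /row_coef.
have -> : 2 * x%:Z + 2 * 2%N%:Z + 1%N%:Z + 1 = 2 * x%:Z + 6 by lia.
have -> : 2 * x%:Z + 2 * 2%N%:Z + 2%N%:Z + 1 = 2 * x%:Z + 7 by lia.
have -> : 2 * x%:Z + 2 * 2%N%:Z + 2 * 1%N%:Z = 2 * x%:Z + 6 by lia.
have -> : 2 * x%:Z + 2 * 2%N%:Z + 2 * 2%N%:Z = 2 * x%:Z + 8 by lia.
rewrite (@factz_shift (2 * x%:Z + 8) (2 * x%:Z + 7)); try by lia.
rewrite (@factz_shift (2 * x%:Z + 7) (2 * x%:Z + 6)); try by lia.
rewrite (@rfactz_shift (2 * x%:Z + 6) (2 * x%:Z + 7)); try by lia.
rewrite (@factz_shift (x%:Z + 2%N%:Z) (x%:Z + 1%N%:Z)); try by lia.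
rewrite (@rfactz_shift (x%:Z + 2%N%:Z + 1%N%:Z) (x%:Z + 2%N%:Z + 2%N%:Z)); try by lia.
have -> : factz (2 * 2%N%:Z - 1%N%:Z - 1) = 2 by [].
have -> : factz (2 * 2%N%:Z - 2%N%:Z - 1) = 1 by [].
have -> : rfactz (1%N%:Z - 1) = 1 by [].
have -> : rfactz (2%N%:Z - 1) = 1 by [].
by ring.
Qed.

Lemma rec_diag_neq0 n j : rec_diag n%:R x%:R j%:R != 0.
Proof.
have x0 : 0 <= x%:R :> rat by []. have n0 : 0 <= n%:R :> rat by [].
have j0 : 0 <= j%:R :> rat by [].
by apply: lt0r_neq0; rewrite /rec_diag !mulr_gt0 //; lra.
Qed.

(** Induction on [n], then on the column: since [rec_diag] is nonzero, the recurrence carries the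
    vanishing from column [j] at both levels to column [j.+1] at the higher one. *)
Lemma alt_sum_eq0 n j : (j < n)%N -> alt_sum x n j = 0.
Proof.
elim: n j => // -[|[|n]] IHn [|j] //; rewrite ?alt_sum0 //.
  case: j => // _; rewrite /alt_sum big_nat_recr //= big_nat1 entry11 entry21.
  by rewrite row_coef2 mulr1 addNr.
rewrite ltnS => jn.
have IHj : alt_sum x n.+3 j = 0.
  elim: j jn => [|j IHj] jn; first exact: alt_sum0.
  have := @alt_sum_rec x n.+2 j isT.
  rewrite (IHn j) ?IHj ?mulr0 ?addr0; try by lia.
  by move/eqP; rewrite mulf_eq0 (negPf (rec_diag_neq0 _ _)) => /eqP.
have := @alt_sum_rec x n.+2 j isT; rewrite (IHn j) // IHj !mulr0 !addr0.
by move/eqP; rewrite mulf_eq0 (negPf (rec_diag_neq0 _ _)) => /eqP.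
Qed.

Lemma gbinom_entry k j :
  gbinom (x%:R + k%:R + j%:R : rat) (2 * j%:Z - k%:Z) = entry x k j.
Proof.
rewrite -!natrD /entry; case e: (2 * j%:Z - k%:Z) => [m|m]; last first.
  by rewrite /= mulr0 mul0r.
rewrite gbinom_nat.
have -> : x%:Z + j%:Z + k%:Z = (x + k + j)%N by lia.
have [ml|ml] := leqP m (x + k + j).
  have -> : x%:Z - j%:Z + 2 * k%:Z = (x + k + j - m)%N by lia.
  rewrite /factz /= -(bin_fact ml) !natrM.
  by field; rewrite !pnatr_eq0 -!lt0n !fact_gt0.
rewrite bin_small //; have : x%:Z - j%:Z + 2 * k%:Z < 0 by lia.
by case: (x%:Z - j%:Z + 2 * k%:Z) => // p _; rewrite mulr0.
Qed.

(** The lower triangular [L] keeps row [0] and replaces each later row by its combination; [L] times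
    the matrix is upper triangular, with corner entry ['C(x, 0) = 1]. *)
Lemma det_binom_mx n :
  \det (binom_mx n.+1 (x%:R : rat)) * \prod_(i < n) row_coef x i.+1 i.+1
  = \prod_(i < n) alt_sum x i.+1 i.+1.
Proof.
pose L : 'M[rat]_n.+1 := \matrix_(i, j) if (i : nat) is 0%N then (j == ord0)%:R
  else if (j : nat) is 0%N then 0 else row_coef x i j.
have LM i j : (L *m binom_mx n.+1 x%:R) i j =
    if (i : nat) is 0%N then entry x 0 j else alt_sum x i j.
  rewrite !mxE; case: i => -[|i] hi.
    rewrite (bigD1 ord0) //= big1 => [|k k0]; last first.
      by rewrite !mxE /= (negPf k0) mul0r.
    by rewrite !mxE gbinom_entry /= mul1r addr0.
  rewrite big_ord_recl !mxE /= mul0r add0r /alt_sum.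
  transitivity (\sum_(1 <= k < n.+1) row_coef x i.+1 k * entry x k j).
    rewrite big_add1 big_mkord; apply: eq_bigr => k _.
    by rewrite !mxE gbinom_entry.
  rewrite (@big_cat_nat _ _ _ i.+2) //= [X in _ + X]big_nat_cond.
  by rewrite [X in _ + X]big1 ?addr0 // => k /andP[/andP[ik _] _]; rewrite row_coef_gt ?mul0r.
have -> : \prod_(i < n) row_coef x i.+1 i.+1 = \det L.
  rewrite det_trig; last first.
    apply/is_trig_mxP => i j ij; rewrite mxE; case: i j ij => -[|i] hi [[|j] hj] //= ij.
    by rewrite row_coef_gt.
  rewrite big_ord_recl mxE /= mul1r; apply: eq_bigr => i _.
  by rewrite mxE.
rewrite mulrC -det_mulmx -det_tr det_trig; last first.
  apply/is_trig_mxP => i j ij; rewrite mxE LM; case: j ij => -[|j] hj //= ij.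
  exact: alt_sum_eq0.
rewrite big_ord_recl mxE LM /= -gbinom_entry !addr0 (gbinom_nat x 0) bin0 mul1r.
by apply: eq_bigr => i _; rewrite mxE LM.
Qed.

End Triangularization.

(** * Linear factors *)

(** The two coefficients are multiples of [common_row n n.+1] and [common_row n n], which
    [common_rowS] compares. *)
Lemma row_coef_diag_rec x n : (1 < n)%N ->
  row_coef x n.+1 n.+1 * ((2 * x%:R + 3 * n%:R + 4) * (2 * x%:R + 3 * n%:R + 3)
    * (2 * x%:R + 3 * n%:R + 2))
  = - 4 * (2 * x%:R + 4 * n%:R + 3) * (2 * x%:R + 4 * n%:R + 1)
    * (x%:R + n%:R + 1) * row_coef x n n.
Proof.
move=> n1; have hr := @common_rowS x n n; rewrite leqnSn ltnW // in hr.
have {}hr := hr isT n1; rewrite row_coefSE ?row_coefE; last by lia.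
move: hr; rewrite -(natr1 n); move: (common_row x n n.+1) (common_row x n n) => c' c hr.
rewrite [RHS](_ : _ = (c * (- 2 * (2 * x%:R + 2 * n%:R + 2 * n%:R + 1)
    * (x%:R + n%:R + 1) * (n%:R + 1 - n%:R)))
  * (2 * (2 * x%:R + 4 * n%:R + 3) * (2 * x%:R + 3 * n%:R + 3)
    * (2 * x%:R + 3 * n%:R + 2))); last by ring.
by rewrite -hr; ring.
Qed.

Lemma alt_sum_diag_rec x n : (1 < n)%N ->
  rec_diag n%:R x%:R n%:R * alt_sum x n.+1 n.+1
  = - 2 * rec_up n%:R x%:R n%:R * alt_sum x n n.
Proof.
move=> n1; have := @alt_sum_rec x n n n1; rewrite (@alt_sum_eq0 x n.+1 n) //.
by rewrite mulr0 addr0 => /eqP; rewrite addr_eq0 => /eqP ->; rewrite !mulNr.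
Qed.

Definition splits (p : {poly rat}) : Prop :=
  exists (c : rat) (s : seq rat), c != 0 /\ p = c%:P * \prod_(a <- s) ('X - a%:P).

Lemma splitsM p q : splits p -> splits q -> splits (p * q).
Proof.
move=> [c [s [c0 ->]]] [d [t [d0 ->]]]; exists (c * d), (s ++ t).
by rewrite mulf_neq0 // big_cat polyCM /=; split=> //; ring.
Qed.

Lemma splitsC c : c != 0 -> splits c%:P.
Proof. by move=> c0; exists c, [::]; rewrite big_nil mulr1. Qed.

Lemma splits_linear a b : a != 0 -> splits (a%:P * 'X + b%:P).
Proof.
move=> a0; exists a, [:: - b / a]; split=> //.
rewrite big_seq1 mulrBr -polyCM; congr (_ + _).
by rewrite -polyCN; congr (_%:P); field.
Qed.

Lemma splits_prod n (F : 'I_n -> {poly rat}) :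
  (forall i, splits (F i)) -> splits (\prod_(i < n) F i).
Proof.
by move=> FP; elim/big_ind: _ => //; [apply: splitsC; rewrite oner_eq0 | exact: splitsM].
Qed.

Lemma splits_dvdp p q : p %| q -> splits q -> splits p.
Proof.
move=> pq [c [s [c0 qE]]]; move: pq; rewrite qE mul_polyC dvdpZr // => /dvdp_prod_XsubC[m].
case/eqpP=> -[a b] /andP[/= a0 b0] e; exists (b / a), (mask m s).
split; first by rewrite mulf_neq0 // invr_eq0.
by rewrite mul_polyC mulrC -scalerA -e scalerA mulVf ?scale1r.
Qed.

Lemma poly_nat_eq (p q : {poly rat}) : (forall x : nat, p.[x%:R] = q.[x%:R]) -> p = q.
Proof.
move=> pq; apply/eqP; rewrite -subr_eq0; apply/negPn/negP => d0.
pose rs := [seq k%:R : rat | k <- iota 0 (size (p - q))].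
have := max_poly_roots d0 (rs := rs); rewrite size_map size_iota ltnn => H.
suff: false by []; apply: H.
  by apply/allP => _ /mapP[k _ ->]; rewrite /root hornerD hornerN pq subrr.
by rewrite map_inj_uniq ?iota_uniq // => a b /eqP; rewrite eqr_nat => /eqP.
Qed.

Lemma diag_ratio_splits i : exists num den : {poly rat},
  [/\ splits num, splits den &
    forall x : nat, alt_sum x i.+1 i.+1 * den.[x%:R]
                    = row_coef x i.+1 i.+1 * num.[x%:R]].
Proof.
have lin a b : a != 0 -> splits (a%:P * 'X + b%:P) by exact: splits_linear.
elim: i => [|[|i] IH].
- exists (1%:P * 'X + 2%:P), 1%:P; split; [exact: lin | exact: splitsC |move=> x].
  rewrite !(hornerM, hornerD, hornerX, hornerC) /alt_sum big_nat1 entry11; ring.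
(* By [row_coef2] the ratio is [(x + 3) * (3 * (x + 4) - (x + 1)) / 6]. *)
- exists ((1%:P * 'X + 3%:P) * (2%:P * 'X + 11%:P)), 6%:P.
  split; [by apply: splitsM; apply: lin | exact: splitsC |move=> x].
  rewrite !(hornerM, hornerD, hornerX, hornerC) /alt_sum big_nat_recr //= big_nat1.
  have h := row_coef2 x; have h2 := entry12 x; have h3 := entry22 x.
  have -> : (row_coef x 2 1 * entry x 1 2 + row_coef x 2 2 * entry x 2 2) * 6 =
    row_coef x 2 1 * (6 * entry x 1 2) + 3 * row_coef x 2 2 * (2 * entry x 2 2) by ring.
  rewrite h2 h3 -[row_coef x 2 2]opprK -h; ring.
case: IH => num [den [numP denP ratio]]; set n : nat := i.+2.
have [A [AP AE]] : exists A, splits A /\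
    forall x : nat, rec_diag n%:R x%:R n%:R = A.[x%:R].
  exists ((2 * (2 * n%:R + 1))%:P * (1%:P * 'X + (3 * n%:R + 1)%:P)
    * (1%:P * 'X + (3 * n%:R + 2)%:P) * (2%:P * 'X + (4 * n%:R + 5)%:P)
    * (2%:P * 'X + (4 * n%:R + 3)%:P)); split.
    repeat first [apply: splitsM | by apply: lin]; apply: splitsC.
    by apply: lt0r_neq0; have : 0 <= n%:R :> rat by []; lra.
  by move=> x; rewrite /rec_diag !(hornerM, hornerD, hornerX, hornerC); ring.
have [C [CP CE]] : exists C, splits C /\
    forall x : nat, rec_up n%:R x%:R n%:R = C.[x%:R].
  exists ((1%:P * 'X + (3 * n%:R + 2)%:P) * (1%:P * 'X + (3 * n%:R + 1)%:P)
    * (2%:P * 'X + (6 * n%:R + 5)%:P) * (2%:P * 'X + (6 * n%:R + 3)%:P)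
    * (2%:P * 'X + (6 * n%:R + 1)%:P)); split.
    by repeat first [apply: splitsM | by apply: lin].
  by move=> x; rewrite /rec_up !(hornerM, hornerD, hornerX, hornerC); ring.
have [E [EP EE]] : exists E, splits E /\ forall x : nat,
    (2 * x%:R + 3 * n%:R + 4) * (2 * x%:R + 3 * n%:R + 3)
      * (2 * x%:R + 3 * n%:R + 2) = E.[x%:R].
  exists ((2%:P * 'X + (3 * n%:R + 4)%:P) * (2%:P * 'X + (3 * n%:R + 3)%:P)
    * (2%:P * 'X + (3 * n%:R + 2)%:P)); split.
    by repeat first [apply: splitsM | by apply: lin].
  by move=> x; rewrite !(hornerM, hornerD, hornerX, hornerC); ring.
have [F [FP FE]] : exists F, splits F /\ forall x : nat,
    - 4 * (2 * x%:R + 4 * n%:R + 3) * (2 * x%:R + 4 * n%:R + 1) * (x%:R + n%:R + 1)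
    = - 2 * F.[x%:R].
  exists (2%:P * (2%:P * 'X + (4 * n%:R + 3)%:P)
    * (2%:P * 'X + (4 * n%:R + 1)%:P) * (1%:P * 'X + (n%:R + 1)%:P)); split.
    by repeat first [apply: splitsM | by apply: lin]; apply: splitsC.
  by move=> x; rewrite !(hornerM, hornerD, hornerX, hornerC); ring.
(* The sum gains the factor [- 2 * C / A] and the coefficient [- 2 * F / E], so their ratio gains
   [C * E / (A * F)]. *)
exists (num * C * E), (den * A * F); split; [by do ?apply: splitsM..|].
move=> x; have := @alt_sum_diag_rec x n isT; have := @row_coef_diag_rec x n isT.
rewrite AE CE EE FE !hornerM; have := ratio x; rewrite -/n.
move: (row_coef x n n) (alt_sum x n n) (row_coef x n.+1 n.+1) (alt_sum x n.+1 n.+1).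
move: num.[x%:R] den.[x%:R] A.[x%:R] C.[x%:R] E.[x%:R] F.[x%:R].
move=> nu de a c e f r s r' s' h1 h2 h3.
transitivity (a * s' * de * f); first by ring.
rewrite h3; transitivity (s * de * (- 2 * c * f)); first by ring.
rewrite h1; transitivity (- 2 * f * r * nu * c); first by ring.
by rewrite -h2; ring.
Qed.

Lemma horner_det_binom_mx n (x : rat) :
  (\det (binom_mx n ('X : {poly rat}))).[x] = \det (binom_mx n x).
Proof.
rewrite -horner_evalE -det_map_mx; congr (\det _); apply/matrixP => i j.
rewrite !mxE; case: (2 * _ - _) => k /=; last by rewrite horner_evalE horner0.
have kE : (k`!)%:R^-1 = ((k`!)%:R^-1)%:P :> {poly rat} by rewrite -polyC_natr polyCV.
rewrite horner_evalE hornerM horner_prod kE hornerC; congr (_ / _).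
by apply: eq_bigr => l _; rewrite -!polyC_natr !(hornerD, hornerN, hornerX, hornerC).
Qed.

Lemma splits_det_binom_mx n : splits (\det (binom_mx n ('X : {poly rat}))).
Proof.
case: n => [|n]; first by rewrite det_mx00; apply: splitsC.
have /fin_all_exists[nd ndP] : forall i : 'I_n, exists nd : {poly rat} * {poly rat},
    [/\ splits nd.1, splits nd.2 &
      forall x : nat, alt_sum x i.+1 i.+1 * nd.2.[x%:R]
                      = row_coef x i.+1 i.+1 * nd.1.[x%:R]].
  by move=> i; have [num [den h]] := diag_ratio_splits i; exists (num, den).
apply: (@splits_dvdp _ (\prod_(i < n) (nd i).1)); last first.
  by apply: splits_prod => i; have [] := ndP i.
(* The determinant times the denominators equals the product of the numerators: at every natural [x]
   the nonzero row coefficients cancel from [det_binom_mx]. *)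
apply/dvdpP; exists (\prod_(i < n) (nd i).2); rewrite mulrC.
apply: poly_nat_eq => x; rewrite hornerM horner_det_binom_mx !horner_prod.
have r0 : \prod_(i < n) row_coef x i.+1 i.+1 != 0.
  by apply/prodf_neq0 => i _; apply: row_coef_diag_neq0.
apply: (mulfI r0); rewrite -big_split /= mulrA [_ * \det _]mulrC det_binom_mx.
rewrite -big_split /=; apply: eq_bigr => i _.
by have [_ _ ->] := ndP i.
Qed.

Theorem mainTheorem8 (n : nat) (hn : (1 <= n)%N) :
  (forall x : nat,
     (#|lozenge_tilings (C_region n x)|)%:R = \det (binom_mx n (x%:R : rat)))
  /\ (exists (c : rat) (s : seq rat), c != 0 /\
        \det (binom_mx n ('X : {poly rat}))
          = c%:P * \prod_(a <- s) ('X - a%:P)).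
Proof. by split; [exact: card_lozenge_tilings | exact: splits_det_binom_mx]. Qed.
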